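(* Let $k\ge 1$ be an integer. The hyperedges of every finite ABA-free hypergraph $\mathcal H$ can be colored with $k$ colors such that for every vertex $v$, if the subfamily $\mathcal H_v$ of hyperedges of $\mathcal H$ containing $v$ has at least $2k-1$ members, then $\mathcal H_v$ contains a hyperedge from each of the $k$ color classes.
   Context: A hypergraph $\mathcal H$ with an ordered vertex set is ABA-free if it does not contain two hyperedges $A$ and $B$ for which there are three vertices $x<y<z$ such that $x,z\in A\setminus B$ and $y\in B\setminus A$. A hypergraph with an unordered vertex set is ABA-free if its vertices have an ordering with which it is ABA-free. *)

(* Defs.v *)
From mathcomp Require Import all_boot.

Set Implicit Arguments.
Unset Strict Implicit.
Unset Printing Implicit Defensive.

Definition strict_linear_order (V : eqType) (lt : rel V) : Prop :=
  [/\ irreflexive lt, transitive lt & forall x y, x != y -> lt x y || lt y x].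

(* A finite hypergraph is given by its vertex set, the whole of a finType V,
   and its set H : {set {set V}} of hyperedges. *)
Definition ABA_free_wrt (V : finType) (lt : rel V) (H : {set {set V}}) : Prop :=
  ~ exists A B : {set V}, [/\ A \in H, B \in H &
      exists x y z : V,
        [/\ lt x y, lt y z, x \in A :\: B, z \in A :\: B & y \in B :\: A]].

Definition ABA_free (V : finType) (H : {set {set V}}) : Prop :=
  exists2 lt : rel V, strict_linear_order lt & ABA_free_wrt lt H.

Definition edges_at (V : finType) (H : {set {set V}}) (v : V) : {set {set V}} :=
  [set A in H | v \in A].

(* Main.v *)
Require Import Defs.
From mathcomp Require Import all_boot.

(** The statement is dual to a vertex-colouring theorem: in an ABA-free family
    over a finite ordered set in which all members have at least [2 * k - 1]
    elements, the elements can be coloured with [k] colours so that every member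
    sees every colour ([polychromatic_vertex_coloring]).

    Duality.  If [A] and [B] are hyperedges of an ABA-free hypergraph, then all
    of [A :\: B] lies on one side of all of [B :\: A]; say that [A] precedes [B]
    when [A :\: B] and [B :\: A] are nonempty and the former lies to the left.
    On the hyperedges this is a strict partial order ([precedes_trans]).  For
    any linear extension of it, the dual family of the sets [edges_at H v] is
    ABA-free ([dual_ABA_free]): if [A < B < C] with [v] in [A] and [C] only and
    [w] in [B] only, then [A < B] forces [v < w], while [B < C] forces [w < v].

    Vertex colouring, by induction on [k].  Call a vertex skippable if some
    member of the family misses it but has elements on both of its sides.  In a
    nonempty inclusion-minimal member of an ABA-free family some vertex is not
    skippable with respect to the minimal members ([exists_unskippable]), so the
    unskippable vertices form a hitting set of the minimal members.  An
    inclusion-minimal hitting set [S] of unskippable vertices meets each minimal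
    member in at most two vertices ([shallow_hitting_set]).  Give [S] one
    colour.  Every member contains a minimal one, hence meets [S] and retains at
    least [2 * k - 1 - 2] elements outside [S], and the traces on the complement
    of [S] are again ABA-free, so the induction hypothesis colours the rest with
    [k - 1] colours. *)

Set Implicit Arguments.
Unset Strict Implicit.
Unset Printing Implicit Defensive.

(** * Finite strict linear orders *)

Lemma slo_asym (V : eqType) (lt : rel V) x y :
  strict_linear_order lt -> lt x y -> lt y x -> False.
Proof. by case=> irr tr _ xy yx; move: (tr _ _ _ xy yx); rewrite irr. Qed.

Lemma slo_total (V : eqType) (lt : rel V) x y :
  strict_linear_order lt -> x != y -> ~~ lt y x -> lt x y.
Proof. by case=> _ _ tot /tot /orP[//|->]. Qed.

Lemma slo_rev (V : eqType) (lt : rel V) :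
  strict_linear_order lt -> strict_linear_order (fun x y => lt y x).
Proof.
case=> irr tr tot; split=> // [y x z xy yz|x y xy]; first exact: tr yz xy.
by rewrite orbC tot.
Qed.

Lemma slo_min (V : finType) (lt : rel V) (S : {set V}) x0 :
  strict_linear_order lt -> x0 \in S ->
  exists2 m, m \in S & forall y, y \in S -> y != m -> lt m y.
Proof.
move=> slo x0S; have [irr tr tot] := slo.
have [m mS minm] := @arg_minnP _ x0 (mem S) (fun x => #|[set y | lt y x]|) x0S.
exists m => // y yS ym; apply: slo_total => //; first by rewrite eq_sym.
apply/negP=> ltym; move: (minm y yS); rewrite leqNgt => /negP; apply.
apply: proper_card; apply/properP; split.
  by apply/subsetP=> z; rewrite !inE => zy; apply: tr zy ltym.
by exists y; rewrite inE // irr.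
Qed.

Lemma slo_max (V : finType) (lt : rel V) (S : {set V}) x0 :
  strict_linear_order lt -> x0 \in S ->
  exists2 m, m \in S & forall y, y \in S -> y != m -> lt y m.
Proof. by move=> /slo_rev slo; apply: slo_min slo. Qed.

(** * ABA-free families *)

Lemma no_ABA (V : finType) (lt : rel V) (H : {set {set V}}) (A B : {set V})
    (x y z : V) :
  ABA_free_wrt lt H -> A \in H -> B \in H -> lt x y -> lt y z ->
  x \in A -> x \notin B -> y \in B -> y \notin A -> z \in A -> z \notin B ->
  False.
Proof.
move=> aba AH BH xy yz xA xB yB yA zA zB; apply: aba.
by exists A, B; split=> //; exists x, y, z; rewrite !inE xA xB yA yB zA zB.
Qed.

Lemma ABA_free_sub (V : finType) (lt : rel V) (F G : {set {set V}}) :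
  F \subset G -> ABA_free_wrt lt G -> ABA_free_wrt lt F.
Proof.
move=> /subsetP sFG aba [A [B [AF BF [x [y [z [xy yz]]]]]]].
rewrite !inE => /andP[xB xA] /andP[zB zA] /andP[yA yB].
by apply: (no_ABA aba (sFG _ AF) (sFG _ BF) xy yz).
Qed.

Lemma ABA_free_trace (V : finType) (lt : rel V) (F : {set {set V}})
    (S : {set V}) :
  ABA_free_wrt lt F -> ABA_free_wrt lt [set A :\: S | A in F].
Proof.
move=> aba [_ [_ [/imsetP[A AF ->] /imsetP[B BF ->]]]].
move=> [x [y [z [xy yz]]]]; rewrite !inE.
case: (x \in S); case: (y \in S); case: (z \in S); rewrite ?andbF //=.
move=> /andP[xB xA] /andP[zB zA] /andP[yA yB].
by apply: (no_ABA aba AF BF xy yz).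
Qed.

(** * Unskippable vertices and shallow hitting sets *)

(** [v] is skippable if some member of [F] avoids [v] and has elements on both
    sides of [v]. *)
Definition skippable (V : finType) (lt : rel V) (F : {set {set V}}) (v : V) :=
  [exists B in F, [&& v \notin B, [exists p in B, lt p v]
                    & [exists q in B, lt v q]]].

Lemma skippableI (V : finType) (lt : rel V) (F : {set {set V}}) v (B : {set V})
    p q :
  B \in F -> v \notin B -> p \in B -> q \in B -> lt p v -> lt v q ->
  skippable lt F v.
Proof.
move=> BF vB pB qB pv vq; apply/existsP; exists B; rewrite BF vB /=.
by apply/andP; split; apply/existsP; [exists p|exists q]; apply/andP.
Qed.

(** [B] skips [v], has a common element with [A] to the left of [v], and sticks
    out of [A] to the right of [v]. *)
Definition right_skips (V : finType) (lt : rel V) (A B : {set V}) (v : V) :=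
  [&& v \notin B, [exists b in A :&: B, lt b v]
    & [exists c in B :\: A, lt v c]].

Lemma right_skipsI (V : finType) (lt : rel V) (A B : {set V}) v b c :
  v \notin B -> b \in A -> b \in B -> lt b v -> c \in B -> c \notin A ->
  lt v c -> right_skips lt A B v.
Proof.
move=> vB bA bB bv cB cA vc; rewrite /right_skips vB /=.
apply/andP; split; apply/existsP; [exists b|exists c]; rewrite !inE.
  by rewrite bA bB.
by rewrite cA cB.
Qed.

(** In an antichain, a member that skips [v \in A] either right-skips it, or has
    a common element with [A] on the right of [v] and sticks out on the left:
    the elements of [B] on the two sides of [v] cannot both lie outside [A]. *)
Lemma skip_sides (V : finType) (lt : rel V) (F : {set {set V}})
    (A : {set V}) v :
  strict_linear_order lt -> ABA_free_wrt lt F ->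
  (forall B C, B \in F -> C \in F -> B \subset C -> B = C) ->
  A \in F -> v \in A -> skippable lt F v ->
  (exists2 B, B \in F & right_skips lt A B v) \/
  (exists2 B, B \in F & v \notin B /\
     exists c d, [/\ c \in B, c \notin A, lt c v
                   & [/\ d \in A, d \in B & lt v d]]).
Proof.
move=> slo aba anti AF vA /existsP[B /andP[BF]].
move=> /and3P[vB /existsP[p /andP[pB pv]] /existsP[q /andP[qB vq]]].
have [pA|pA] := boolP (p \in A); have [qA|qA] := boolP (q \in A).
- have /subsetPn[c cB cA] : ~~ (B \subset A).
    by apply/negP=> /(anti _ _ BF AF) eBA; rewrite eBA vA in vB.
  have vc : v != c by apply: contraNneq cA => <-.
  have [ltvc|gevc] := boolP (lt v c); [left|right]; exists B => //.
    exact: right_skipsI vB pA pB pv cB cA ltvc.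
  by split=> //; exists c, q; split=> //; apply: slo_total; rewrite // eq_sym.
- by left; exists B => //; apply: right_skipsI vB pA pB pv qB qA vq.
- by right; exists B => //; split=> //; exists p, q.
- by case: (no_ABA aba BF AF pv vq pB pA vA vB qB qA).
Qed.

(** The last vertex [u] of [A] that is right-skipped by no member works.  If
    some [B'] skipped it, then [B'] would stick out of [A] on the left of [u]
    and share with [A] a vertex on its right; the first such vertex [d] comes
    after [u], so it is right-skipped by some [B], and [A], [B], [B'] together
    then contain a forbidden pattern. *)
Lemma exists_unskippable (V : finType) (lt : rel V) (F : {set {set V}})
    (A : {set V}) :
  strict_linear_order lt -> ABA_free_wrt lt F ->
  (forall B C, B \in F -> C \in F -> B \subset C -> B = C) ->
  A \in F -> A != set0 -> exists2 v, v \in A & ~~ skippable lt F v.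
Proof.
move=> slo aba anti AF /set0Pn[x0 x0A].
have [irr tr tot] := slo.
pose U := [set u in A | ~~ [exists B in F, right_skips lt A B u]].
have [m mA minm] := slo_min slo x0A.
have mU : m \in U.
  rewrite inE mA /=; apply/existsP=> -[B /andP[BF /and3P[mB]]].
  case/existsP=> b; rewrite !inE => /andP[/andP[bA bB] bm] _.
  have bNm : b != m by apply: contraNneq mB => <-.
  exact: slo_asym slo bm (minm b bA bNm).
have [u uU maxu] := slo_max slo mU.
have [uA uN] : u \in A /\ ~~ [exists B in F, right_skips lt A B u].
  by apply/andP; rewrite inE in uU.
exists u => //; apply/negP=> /(skip_sides slo aba anti AF uA) [] [B' B'F].
  by move=> sk; case/negP: uN; apply/existsP; exists B'; rewrite B'F.
move=> [uB' [c' [d0 [c'B' c'A c'u [d0A d0B' ud0]]]]].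
have d0D : d0 \in [set x in A :&: B' | lt u x] by rewrite !inE d0A d0B'.
have [d] := slo_min slo d0D.
rewrite !inE => /andP[/andP[dA dB'] ud] mind.
have du : d != u by apply: contraTneq ud => ->; rewrite irr.
have : d \notin U by apply/negP=> /maxu /(_ du) /(slo_asym slo ud).
rewrite inE dA negbK => /existsP[B /andP[BF /and3P[dB]]].
move=> /existsP[b]; rewrite !inE => /andP[/andP[bA bB] bd].
move=> /existsP[c]; rewrite !inE => /andP[/andP[cA cB] dc].
have c'd : lt c' d := tr _ _ _ c'u ud.
have c'B : c' \notin B.
  by apply/negP=> c'B; case: (no_ABA aba BF AF c'd dc).
have [bB'|bB'] := boolP (b \in B').
- have bu : b != u by apply: contraNneq uB' => <-.
  have [ub|nub] := boolP (lt u b).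
    have bNd : b != d by apply: contraNneq dB => <-.
    apply: (slo_asym slo bd); apply: mind => //.
    by rewrite !inE bA bB' ub.
  have [uB|uB] := boolP (u \in B).
    by case: (no_ABA aba B'F BF c'u ud).
  case/negP: uN; apply/existsP; exists B; rewrite BF /=.
  apply: (right_skipsI uB bA bB _ cB cA (tr _ _ _ ud dc)).
  exact: slo_total.
- have c'b : lt c' b.
    apply: slo_total => //; first by apply: contraNneq c'A => ->.
    by apply/negP=> bc'; case: (no_ABA aba AF B'F bc' c'u).
  by case: (no_ABA aba B'F BF c'b bd).
Qed.

(** Three elements [a < b < c] of [A :&: S] are impossible: by minimality of
    [S] some member [B] meets [S] in [b] only.  As the members form an
    antichain, [B] has an element outside [A]; it cannot lie between [a] and
    [c] because the family is ABA-free, nor beyond them because [a] and [c] are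
    not skippable. *)
Lemma shallow_hitting_set (V : finType) (lt : rel V) (F : {set {set V}}) :
  strict_linear_order lt -> ABA_free_wrt lt F -> set0 \notin F ->
  (forall B C, B \in F -> C \in F -> B \subset C -> B = C) ->
  exists S : {set V},
    forall A, A \in F -> A :&: S != set0 /\ #|A :&: S| <= 2.
Proof.
move=> slo aba F0 anti; have [irr tr tot] := slo.
pose hits (S : {set V}) := (S \subset [set v | ~~ skippable lt F v]) &&
  [forall A in F, A :&: S != set0].
have hits_all : hits [set v | ~~ skippable lt F v].
  rewrite /hits subxx; apply/forall_inP=> A AF.
  have A0 : A != set0 by apply: contraNneq F0 => <-.
  have [v vA vU] := exists_unskippable slo aba anti AF A0.
  by apply/set0Pn; exists v; rewrite !inE vA.
have [S /minsetP[/andP[/subsetP SU /forall_inP hitS] minS] _] :=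
  minset_exists hits_all.
exists S => A AF; split; first exact: hitS.
rewrite leqNgt; apply/negP=> card3.
have /set0Pn[x xAS] := hitS A AF.
have [a aAS mina] := slo_min slo xAS.
have [c cAS maxc] := slo_max slo xAS.
have /subsetPn[b bAS] : ~~ (A :&: S \subset [set a; c]).
  apply/negP=> /subset_leq_card; rewrite leqNgt => /negP; apply.
  by apply: leq_ltn_trans card3; rewrite cards2; case: eqP.
rewrite !inE negb_or => /andP[ba bc].
have {mina} ab := mina _ bAS ba; have {maxc} bc' := maxc _ bAS bc.
move: aAS bAS cAS; rewrite !inE => /andP[aA aS] /andP[bA bS] /andP[cA cS].
(* By minimality of [S] there is a member [B] that [S] meets only in [b]. *)
have [B BF BS] : exists2 B, B \in F & B :&: (S :\ b) = set0.
  have : ~~ hits (S :\ b).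
    apply/negP=> /minS /(_ (subsetDl _ _)) eS.
    by move: bS; rewrite -eS !inE eqxx.
  rewrite negb_and => /orP[/negP[]|].
    by apply/subsetP=> z; rewrite in_setD1 => /andP[_ /SU].
  by case/forall_inPn=> B BF /negPn/eqP; exists B.
have notB z : z \in S -> z != b -> z \notin B.
  move=> zS zb; apply/negP=> zB.
  by have := in_set0 z; rewrite -BS !inE zb zS zB.
have bB : b \in B.
  have /set0Pn[z] := hitS B BF; rewrite inE => /andP[zB zS].
  by have [<-//|/(notB _ zS)] := eqVneq z b; rewrite zB.
have aB : a \notin B by apply: notB; rewrite // eq_sym.
have cB : c \notin B by apply: notB; rewrite // eq_sym.
have aU := SU _ aS; have cU := SU _ cS; rewrite !inE in aU cU.
have /subsetPn[y yB yA] : ~~ (B \subset A).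
  by apply/negP=> /(anti _ _ BF AF) eBA; rewrite eBA aA in aB.
have ya : y != a by apply: contraNneq yA => ->.
have yc : y != c by apply: contraNneq yA => ->.
have [lya|nya] := boolP (lt y a).
  by case/negP: aU; apply: skippableI BF aB yB bB lya ab.
have [lcy|ncy] := boolP (lt c y).
  by case/negP: cU; apply: skippableI BF cB bB yB bc' lcy.
have ay : lt a y by apply: slo_total; rewrite // eq_sym.
have lyc : lt y c by apply: slo_total.
by case: (no_ABA aba AF BF ay lyc).
Qed.

(** * Polychromatic colouring of the vertices *)

(** The colours are natural numbers, of which only those below [k] matter; this
    makes [k = 0] a trivial base case. *)
Lemma polychromatic_vertex_coloring (V : finType) (lt : rel V) (k : nat)
    (F : {set {set V}}) :
  strict_linear_order lt -> ABA_free_wrt lt F ->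
  (forall A, A \in F -> 2 * k - 1 <= #|A|) ->
  exists c : V -> nat,
    forall A, A \in F -> forall i, i < k -> exists2 x, x \in A & c x = i.
Proof.
move=> slo; elim: k F => [|k IHk] F aba big; first by exists (fun=> 0).
pose F0 := [set A in F | minset (fun B => B \in F) A].
have F0F : F0 \subset F by apply/subsetP=> A; rewrite inE => /andP[].
have below A : A \in F -> exists2 B, B \in F0 & B \subset A.
  move=> AF; have [B mB sBA] := @minset_exists _ (fun B => B \in F) A AF.
  by exists B; rewrite // inE mB (minsetp mB).
have F0n : set0 \notin F0.
  by apply/negP=> /(subsetP F0F) /big; rewrite cards0 mulnS; by [].
have anti B C : B \in F0 -> C \in F0 -> B \subset C -> B = C.
  rewrite !inE => /andP[BF _] /andP[_ /minsetP[_ minC]] sBC.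
  exact: minC.
have [S hS] := shallow_hitting_set slo (ABA_free_sub F0F aba) F0n anti.
have [|c hc] := IHk [set A :\: S | A in F] (ABA_free_trace aba).
  move=> _ /imsetP[A AF ->].
  have [B BF0 sBA] := below A AF; have [_ BS2] := hS B BF0.
  apply: (@leq_trans #|B :\: S|); last exact/subset_leq_card/setSD.
  rewrite cardsD; apply: leq_trans (leq_sub (big B (subsetP F0F _ BF0)) BS2).
  by rewrite mulnS subnAC addKn.
exists (fun x => if x \in S then k else c x) => A AF i.
rewrite ltnS leq_eqVlt => /predU1P[->|ik].
  have [B BF0 sBA] := below A AF; have [/set0Pn[x]] := hS B BF0.
  rewrite inE => /andP[xB xS] _.
  by exists x; rewrite ?xS // (subsetP sBA).
have [x] := hc _ (imset_f (fun B => B :\: S) AF) i ik.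
by rewrite inE => /andP[xS xA] cx; exists x; rewrite // (negbTE xS).
Qed.

(** * The dual hypergraph *)

(** Some element of [A :\: B] lies to the left of some element of [B :\: A]. *)
Definition precedes (V : finType) (lt : rel V) (A B : {set V}) :=
  [exists x in A :\: B, exists y in B :\: A, lt x y].

Lemma precedesP (V : finType) (lt : rel V) (A B : {set V}) :
  reflect (exists x y, [/\ x \in A, x \notin B, y \in B, y \notin A & lt x y])
          (precedes lt A B).
Proof.
apply: (iffP existsP) => [[x] | [x [y [xA xB yB yA xy]]]].
  rewrite inE => /andP[/andP[xB xA] /existsP[y]].
  by rewrite inE => /andP[/andP[yA yB] xy]; exists x, y.
exists x; rewrite inE xA xB; apply/existsP; exists y.
by rewrite inE yA yB.
Qed.

Lemma precedes_lt (V : finType) (lt : rel V) (H : {set {set V}})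
    (A B : {set V}) u w :
  strict_linear_order lt -> ABA_free_wrt lt H -> A \in H -> B \in H ->
  precedes lt A B -> u \in A -> u \notin B -> w \in B -> w \notin A -> lt u w.
Proof.
move=> slo aba AH BH /precedesP[x [y [xA xB yB yA xy]]] uA uB wB wA.
have uw : u != w by apply: contraNneq uB => ->.
have uy : u != y by apply: contraNneq uB => ->.
apply: slo_total => //; apply/negP=> wu.
have [yu|nyu] := boolP (lt y u).
  by case: (no_ABA aba AH BH xy yu).
by case: (no_ABA aba BH AH wu (slo_total slo uy nyu)).
Qed.

Lemma precedes_trans (V : finType) (lt : rel V) (H : {set {set V}})
    (A B C : {set V}) :
  strict_linear_order lt -> ABA_free_wrt lt H ->
  A \in H -> B \in H -> C \in H ->
  precedes lt A B -> precedes lt B C -> precedes lt A C.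
Proof.
move=> slo aba AH BH CH AB BC; have [irr tr _] := slo.
have ltAB := precedes_lt slo aba AH BH AB.
have ltBC := precedes_lt slo aba BH CH BC.
case/precedesP: AB => x [y [xA xB yB yA xy]].
case/precedesP: BC => z [w [zB zC wC wB zw]].
(* The left witness is [x], or [z] if [x] belongs to [C]. *)
have [p [pA pC py]] : exists p, [/\ p \in A, p \notin C & lt p y].
  have [xC|xC] := boolP (x \in C); last by exists x.
  have zx := ltBC _ _ zB zC xC xB.
  exists z; split=> //; last exact: tr zx xy.
  by apply/negPn/negP=> zA; apply: slo_asym slo zx (ltAB _ _ _ _ _ _).
apply/precedesP.
have [yC|yC] := boolP (y \in C); first by exists p, y.
have yw := ltBC _ _ yB yC wC wB.
exists p, w; split=> //; last exact: tr py yw.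
by apply/negP=> wA; apply: slo_asym slo yw (ltAB _ _ _ _ _ _).
Qed.

(** The number of hyperedges that precede [A]. *)
Definition edge_rank (V : finType) (lt : rel V) (H : {set {set V}})
  (A : {set V}) := #|[set B in H | precedes lt B A]|.

(** A linear extension of [precedes]: hyperedges are compared by rank, and ties
    are broken by the enumeration of the finite type of all vertex sets. *)
Definition edge_lt (V : finType) (lt : rel V) (H : {set {set V}}) :
    rel {set V} :=
  fun A B => (edge_rank lt H A < edge_rank lt H B) ||
    (edge_rank lt H A == edge_rank lt H B) && (enum_rank A < enum_rank B).

Lemma edge_lt_slo (V : finType) (lt : rel V) (H : {set {set V}}) :
  strict_linear_order (edge_lt lt H).
Proof.
rewrite /edge_lt; split.
- by move=> A; rewrite !ltnn andbF.
- move=> B A C /orP[ab|/andP[/eqP-> ab]] /orP[bc|/andP[/eqP<- bc]].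
  + by rewrite (ltn_trans ab bc).
  + by rewrite ab.
  + by rewrite bc.
  + by rewrite eqxx (ltn_trans ab bc) orbT.
- move=> A B AB; case: ltngtP => //= _.
  by rewrite -neq_ltn; apply: contraNneq AB => /val_inj/enum_rank_inj ->.
Qed.

Lemma precedes_edge_rank (V : finType) (lt : rel V) (H : {set {set V}})
    (A B : {set V}) :
  strict_linear_order lt -> ABA_free_wrt lt H -> A \in H -> B \in H ->
  precedes lt A B -> edge_rank lt H A < edge_rank lt H B.
Proof.
move=> slo aba AH BH AB; apply: proper_card; apply/properP; split.
  apply/subsetP=> C; rewrite !inE => /andP[CH CA]; rewrite CH.
  exact: precedes_trans slo aba CH AH BH CA AB.
exists A; rewrite inE AH //=.
by apply/precedesP=> -[x [y [xA]]]; rewrite xA.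
Qed.

Lemma edge_lt_separates (V : finType) (lt : rel V) (H : {set {set V}})
    (A B : {set V}) v w :
  strict_linear_order lt -> ABA_free_wrt lt H -> A \in H -> B \in H ->
  edge_lt lt H A B ->
  v \in A -> v \notin B -> w \in B -> w \notin A -> lt v w.
Proof.
move=> slo aba AH BH AB vA vB wB wA; apply: slo_total => //.
  by apply: contraNneq vB => ->.
apply/negP=> wv.
have /(precedes_edge_rank slo aba BH AH) BA : precedes lt B A.
  by apply/precedesP; exists w, v.
by move: AB; rewrite /edge_lt ltnNge (ltnW BA) /= gtn_eqF.
Qed.

Lemma dual_ABA_free (V : finType) (lt : rel V) (H : {set {set V}}) :
  strict_linear_order lt -> ABA_free_wrt lt H ->
  ABA_free_wrt (edge_lt lt H) [set edges_at H v | v : V].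
Proof.
move=> slo aba [_ [_ [/imsetP[v _ ->] /imsetP[w _ ->]]]].
move=> [A [B [C [AB BC]]]]; rewrite !inE.
case: (boolP (A \in H)) => //= AH; case: (boolP (C \in H)) => //= CH;
  case: (boolP (B \in H)) => //= BH; rewrite ?andbF //.
move=> /andP[wA vA] /andP[wC vC] /andP[vB wB].
have vw := edge_lt_separates slo aba AH BH AB vA vB wB wA.
exact: slo_asym slo vw (edge_lt_separates slo aba BH CH BC wB wC vC vB).
Qed.

Theorem corollary2p17 (k : nat) (hk : 1 <= k) (V : finType) (H : {set {set V}})
    (hH : ABA_free H) :
  exists c : {set V} -> 'I_k,
    forall v : V, 2 * k - 1 <= #|edges_at H v| ->
      forall i : 'I_k, exists2 A : {set V}, A \in edges_at H v & c A = i.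
Proof.
case: hH => lt slo aba.
pose F := [set E in [set edges_at H v | v : V] | 2 * k - 1 <= #|E|].
have FD : F \subset [set edges_at H v | v : V].
  by apply/subsetP=> E; rewrite inE => /andP[].
have [|c hc] := polychromatic_vertex_coloring (k := k) (edge_lt_slo lt H)
  (ABA_free_sub FD (dual_ABA_free slo aba)).
  by move=> E; rewrite inE => /andP[].
case: k hk @F FD hc => // k _ F _ hc.
exists (fun A => inord (c A)) => v big i.
have vF : edges_at H v \in F by rewrite inE big andbT imset_f.
have [A Av cA] := hc _ vF i (ltn_ord i).
by exists A; rewrite // cA inord_val.
Qed.
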